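(* Let $G$ be a topological group. Let $2^{-}:G\curvearrowright\mathbf{CH}\to G\curvearrowright\mathbf{CH}$ be the endofunctor sending a partial action $\alpha=(\alpha_g,X_g)_{g\in G}$ on $X$ to the induced partial action $2^{\alpha}$ on $2^X$, and a morphism $f$ to $2^f:A\mapsto f(A)$. For each object $\alpha$, a partial action on $X$, let $\eta_\alpha:X\to2^X$, $x\mapsto\{x\}$, and $\mu_\alpha:2^{2^X}\to2^X$, $A\mapsto\bigcup A$, and put $\eta=\{\eta_\alpha\}_\alpha$, $\mu=\{\mu_\alpha\}_\alpha$. Then the triple $\mathbb{I}=(2^{-},\eta,\mu)$ is a monad in the category $G\curvearrowright\mathbf{CH}$.
   Context: Partial actions. A (set-theoretic) partial action of a group $G$ on a set $X$ is a partially defined function $\theta:G\times X\dashrightarrow X$, $(g,x)\mapsto g\cdot x$ (write $\exists g\cdot x$ if $g\cdot x$ is defined), such that for all $g,h\in G$, $x\in X$: (PA1) if $\exists g\cdot x$ then $\exists g^{-1}\cdot(g\cdot x)$ and $g^{-1}\cdot(g\cdot x)=x$; (PA2) if $\exists g\cdot(h\cdot x)$ then $\exists (gh)\cdot x$ and $g\cdot(h\cdot x)=(gh)\cdot x$; (PA3) $\exists 1\cdot x$ and $1\cdot x=x$. Put $X_g=\{x\in X:\exists g^{-1}\cdot x\}$; then $\theta$ is determined by the bijections $\theta_g:X_{g^{-1}}\to X_g$, $x\mapsto g\cdot x$, and one writes $\theta=(\theta_g,X_g)_{g\in G}$. For $G$ a topological group and $X$ a topological space, $\theta$ is a topological partial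 action if every $X_g$ is open in $X$ and every $\theta_g$ is a homeomorphism. Hyperspace. For a compact Hausdorff space $X$, $2^X$ is the set of non-empty compact subsets of $X$ with the Vietoris topology, generated by the sets $\langle U_1,\dots,U_n\rangle=\{A\in2^X: A\subseteq\bigcup_{i=1}^nU_i,\ A\cap U_i\ne\emptyset\ (1\le i\le n)\}$ for non-empty open $U_1,\dots,U_n\subseteq X$; $\langle\emptyset\rangle:=\emptyset$. So $\langle U\rangle=\{A\in 2^X:A\subseteq U\}$. $2^X$ is again a compact Hausdorff space. For a topological partial action $\alpha=(\alpha_g,X_g)_{g\in G}$ on $X$, the induced partial action is the topological partial action $2^{\alpha}=(2^{\alpha_g},\langle X_g\rangle)_{g\in G}$ on $2^X$, where $2^{\alpha_g}:\langle X_{g^{-1}}\rangle\to\langle X_g\rangle$, $A\mapsto\alpha_g(A)$. Category. Objects of $G\curvearrowright\mathbf{CH}$ are the topological partial actions of $G$ on compact Hausdorff spaces. A morphism ($G$-map) $f:\phi\to\psi$ from $\phi=(\phi_g,X_g)_{g\in G}$ on $X$ to $\psi=(\psi_g,Y_g)_{g\in G}$ on $Y$ is a continuous map $f:X\to Y$ such that for every $g\in G$: $f(X_g)\subseteq Y_g$, and $f(\phi_g(x))=\psi_g(f(x))$ for each $x\in X_{g^{-1}}$. Monad. A monad in a category $\mathcal{C}$ is a triple $(T,\eta,\mu)$ with $T:\mathcal{C}\to\mathcal{C}$ an endofunctor and $\eta:\mathrm{Id}_{\mathcal{C}}\Rightarrow T$, $\mu:T^2\Rightarrow T$ natural transformations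 such that $\mu\circ T\eta=\mu\circ\eta T=1_T$ and $\mu\circ\mu T=\mu\circ T\mu$. *)

(* Defs.v *)
From HB Require Import structures.
From mathcomp Require Import all_boot all_order finmap.
From mathcomp Require Import all_classical.
From mathcomp Require Import topology.

Set Implicit Arguments.
Unset Strict Implicit.
Unset Printing Implicit Defensive.

Local Open Scope classical_set_scope.

Local Notation "1" := (@monoid.one _) : group_scope.
Local Notation "x * y" := (monoid.mul x y) : group_scope.
Local Notation "x ^-1" := (monoid.inv x) : group_scope.

Record category := Category {
  ob :> Type ;
  hom : ob -> ob -> Type ;
  idm : forall a, hom a a ;
  comp : forall a b c, hom b c -> hom a b -> hom a c ;
  comp1m : forall a b (f : hom a b), comp (idm b) f = f ;
  compm1 : forall a b (f : hom a b), comp f (idm a) = f ;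
  compmA : forall a b c d (h : hom c d) (g : hom b c) (f : hom a b),
    comp h (comp g f) = comp (comp h g) f
}.

Record functor (C D : category) := Functor {
  fobj :> C -> D ;
  fmap : forall a b : C, hom a b -> hom (fobj a) (fobj b) ;
  fmap1 : forall a, fmap (idm a) = idm (fobj a) ;
  fmapM : forall a b c (g : hom b c) (f : hom a b),
    fmap (comp g f) = comp (fmap g) (fmap f)
}.

Program Definition functor_id (C : category) : functor C C :=
  {| fobj := fun a => a ; fmap := fun a b f => f |}.
Next Obligation. by []. Qed.
Next Obligation. by []. Qed.

Program Definition functor_comp (C D E : category)
    (S : functor D E) (T : functor C D) : functor C E :=
  {| fobj := fun a => S (T a) ; fmap := fun a b f => fmap S (fmap T f) |}.
Next Obligation. by move=> * /=; rewrite !fmap1. Qed.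
Next Obligation. by move=> * /=; rewrite !fmapM. Qed.

Record nat_trans (C D : category) (S T : functor C D) := NatTrans {
  component :> forall a : C, hom (S a) (T a) ;
  naturality : forall (a b : C) (f : hom a b),
    comp (component b) (fmap S f) = comp (fmap T f) (component a)
}.

Definition is_monad (C : category) (T : functor C C)
    (eta : nat_trans (functor_id C) T)
    (mu : nat_trans (functor_comp T T) T) : Prop :=
  [/\ forall a : C, comp (mu a) (fmap T (eta a)) = idm (T a),
      forall a : C, comp (mu a) (eta (T a)) = idm (T a) &
      forall a : C, comp (mu a) (mu (T a)) = comp (mu a) (fmap T (mu a)) ].

(* No separation axiom is assumed. *)
HB.mixin Record isTopologicalGroup G & Group G & Topological G := {
  mulg_continuous : continuous (fun p : G * G => (p.1 * p.2)%g) ;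
  invg_continuous : continuous (fun x : G => (x^-1)%g)
}.

#[short(type="topologicalGroupType")]
HB.structure Definition TopologicalGroup :=
  {G of Group G & Topological G & isTopologicalGroup G}.

(* [pact g x = Some y] means that g.x is defined and equal to y. *)
Record partial_action (G : groupType) (X : Type) := PartialAction {
  pact :> G -> X -> option X ;
  pactV : forall g x y, pact g x = Some y -> pact g^-1%g y = Some x ;
  pactM : forall g h x y z,
    pact h x = Some y -> pact g y = Some z -> pact (g * h)%g x = Some z ;
  pact1 : forall x, pact 1%g x = Some x
}.

(* X_g, the domain of g^-1 and the range of g *)
Definition pdom (G : groupType) X (a : partial_action G X) (g : G) : set X :=
  [set x | isSome (a g^-1%g x)].

(* The bijection X_{g^-1} -> X_g, x |-> g.x; the value outside of X_{g^-1} is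
   irrelevant. *)
Definition pfun (G : groupType) X (a : partial_action G X) (g : G) (x : X) : X :=
  odflt x (a g x).

Definition homeo_on (X : topologicalType) (A B : set X) (f : X -> X) : Prop :=
  [/\ set_bij A B f, {within A, continuous f} &
      exists f' : X -> X,
        (forall x, A x -> f' (f x) = x) /\ {within B, continuous f'} ].

Definition topological_pact (G : topologicalGroupType) (X : topologicalType)
    (a : partial_action G X) : Prop :=
  (forall g, open (pdom a g)) /\
  (forall g, homeo_on (pdom a g^-1%g) (pdom a g) (pfun a g)).

Section PartialActionTheory.
Variables (G : groupType) (X : Type) (a : partial_action G X).

Lemma pdomVP g x : pdom a g^-1%g x <-> exists y, a g x = Some y.
Proof.
rewrite /pdom /= invgK; split=> [|[y ->]//].
by case: (a g x) => // y _; exists y.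
Qed.

Lemma pdomP g x : pdom a g x <-> exists y, a g^-1%g x = Some y.
Proof. by rewrite -{1}[g]invgK pdomVP. Qed.

Lemma pfunE g x y : a g x = Some y -> pfun a g x = y.
Proof. by rewrite /pfun => ->. Qed.

Lemma pactE g x : pdom a g^-1%g x -> a g x = Some (pfun a g x).
Proof. by move=> /pdomVP[y ay]; rewrite (pfunE ay). Qed.

Lemma pdom_pfun g x : pdom a g^-1%g x -> pdom a g (pfun a g x).
Proof. by move=> gx; apply/pdomP; exists x; exact/pactV/pactE. Qed.

Lemma pfunK g x : pdom a g^-1%g x -> pfun a g^-1%g (pfun a g x) = x.
Proof. by move=> gx; exact/pfunE/pactV/pactE. Qed.

Lemma pfunVK g x : pdom a g x -> pfun a g (pfun a g^-1%g x) = x.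
Proof. by move=> gx; have := @pfunK g^-1%g x; rewrite invgK; apply. Qed.

Lemma pdom_pfunV g x : pdom a g x -> pdom a g^-1%g (pfun a g^-1%g x).
Proof. by move=> gx; apply: pdom_pfun; rewrite invgK. Qed.

Lemma pfun_bij g : set_bij (pdom a g^-1%g) (pdom a g) (pfun a g).
Proof.
split; first by move=> x; exact: pdom_pfun.
- by move=> x y /set_mem gx /set_mem gy /(congr1 (pfun a g^-1%g)); rewrite !pfunK.
- by move=> y gy; exists (pfun a g^-1%g y);
    [exact: pdom_pfunV | exact: pfunVK].
Qed.

End PartialActionTheory.

(* The inverse of x |-> g.x is x |-> g^-1.x, so continuity for all g is enough. *)
Lemma topological_pactI (G : topologicalGroupType) (X : topologicalType)
    (a : partial_action G X) :
  (forall g, open (pdom a g)) ->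
  (forall g, {within pdom a g^-1%g, continuous (pfun a g)}) ->
  topological_pact a.
Proof.
move=> oa ca; split=> // g; split; [exact: pfun_bij|exact: ca|].
exists (pfun a g^-1%g); split; first by move=> x; exact: pfunK.
by have := ca g^-1%g; rewrite invgK.
Qed.

Record hyperspace (X : topologicalType) := Hyperspace {
  hset :> set X ;
  hset_compact : compact hset ;
  hset_neq0 : hset !=set0
}.

HB.instance Definition _ (X : topologicalType) := gen_eqMixin (hyperspace X).
HB.instance Definition _ (X : topologicalType) := gen_choiceMixin (hyperspace X).

(* <U_1, ..., U_n> *)
Definition vietoris_set (X : topologicalType) n (U : 'I_n -> set X) :
    set (hyperspace X) :=
  [set A | hset A `<=` \bigcup_i U i /\ forall i, hset A `&` U i !=set0].

Definition vietoris_sets (X : topologicalType) : set (set (hyperspace X)) :=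
  [set B | exists n (U : 'I_n.+1 -> set X),
     (forall i, open (U i) /\ U i !=set0) /\ B = vietoris_set U].

HB.instance Definition _ (X : topologicalType) :=
  isSubBaseTopological.Build (hyperspace X) (@vietoris_sets X) id.

Section HyperspaceTheory.
Variable X : topologicalType.
Implicit Types A B : hyperspace X.

Lemma hset_inj : injective (@hset X).
Proof.
move=> [A cA A0] [B cB B0] /= AB; move: cA A0 cB B0; rewrite AB => *.
by congr Hyperspace; exact: Prop_irrelevance.
Qed.

Definition hsub (U : set X) : set (hyperspace X) := [set A | hset A `<=` U].
Definition hhit (U : set X) : set (hyperspace X) := [set A | hset A `&` U !=set0].

Lemma open_vietoris (B : set (hyperspace X)) : vietoris_sets B -> open B.
Proof.
move=> vB; exists [set B]; last by rewrite bigcup_set1.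
move=> _ ->; exists [fset B]%fset; first by move=> C /fset1P ->; rewrite inE.
by rewrite set_fset1 bigcap_set1.
Qed.

Lemma open_hsub U : open U -> open (hsub U).
Proof.
move=> oU; have [->|/set0P U0] := eqVneq U set0.
  rewrite (_ : hsub set0 = set0) ?predeqE; first exact: open0.
  by move=> A; split=> // /= A0; have [x /A0] := hset_neq0 A.
apply: open_vietoris; exists 0, (fun=> U); split=> //.
rewrite predeqE => A; split=> [AU|[AU _] x /AU[]//].
split=> [x /AU Ux|_]; first by exists ord0.
by have [x Ax] := hset_neq0 A; exists x; split=> //; exact: AU.
Qed.

Lemma open_hhit U : open U -> open (hhit U).
Proof.
move=> oU; have [->|/set0P U0] := eqVneq U set0.
  rewrite (_ : hhit set0 = set0) ?predeqE; first exact: open0.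
  by move=> A; split=> // -[x []].
apply: open_vietoris.
exists 1, (fun i : 'I_2 => if i == ord0 then setT else U); split=> [i|].
  case: ifP => // _; split; first exact: openT.
  by have [x _] := U0; exists x.
rewrite predeqE => A; split=> [AU|[_ /(_ ord_max)]//].
split=> [x Ax|i]; first by exists ord0.
by case: ifP => // _; rewrite setIT; exact: hset_neq0.
Qed.

Lemma nbhs_hsub A U : open U -> hset A `<=` U -> nbhs A (hsub U).
Proof. by move=> /open_hsub oU AU; exact: open_nbhs_nbhs. Qed.

Lemma nbhs_hhit A U : open U -> hset A `&` U !=set0 -> nbhs A (hhit U).
Proof. by move=> /open_hhit oU AU; exact: open_nbhs_nbhs. Qed.

Lemma hcvg (F : set_system (hyperspace X)) A : Filter F ->
  (forall U, open U -> hset A `<=` U -> F (hsub U)) ->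
  (forall U, open U -> hset A `&` U !=set0 -> F (hhit U)) ->
  F --> A.
Proof.
move=> FF Fsub Fhit W; rewrite nbhsE => -[V [[D sD <-] [E DE EA]] VW].
apply: (filterS VW); apply: (@filterS _ F FF E); first by move=> B EB; exists E.
have [D' sD' ED'] := sD _ DE; rewrite -ED' in EA *.
apply: filter_bigI => B BD'.
have /set_mem [n [U [oU BU]]] := sD' _ BD'.
have [AU AUi] : vietoris_set U A by rewrite -BU; exact: EA.
rewrite /= BU; apply: filterI.
  by apply: Fsub => //; apply: bigcup_open => i _; exact: (oU i).1.
have := @filter_forall _ 'I_n.+1 (fun i => hhit (U i)) F FF; apply=> i.
by apply: Fhit => //; exact: (oU i).1.
Qed.

Lemma hyperspace_compact : compact [set: X] -> compact [set: hyperspace X].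
Proof.
move=> cX; rewrite compact_ultra => F FU _.
have FF : ProperFilter F by exact: ultra_proper.
pose L := [set x : X | forall U, open U -> U x -> F (hhit U)].
have avoid K : compact K -> K `&` L = set0 -> F (hsub (~` K)).
  move=> /compact_near_coveringP cK KL0.
  pose P A x := ~ hset A x.
  suff KP x : K x -> \forall x' \near x & A \near F, P A x'.
    apply: filterS (cK _ F P _ KP) => A /= KA x Ax Kx; exact: KA Kx Ax.
  move=> Kx; have : ~ L x.
    by move=> Lx; have : (K `&` L) x by []; rewrite KL0.
  move=> /existsNP[U /not_implyP[oU /not_implyP[Ux nF]]].
  exists (U, ~` hhit U) => /=.
    split; first exact: open_nbhs_nbhs.
    by have [] := in_ultra_setVsetC (hhit U) FU.
  by move=> [y A] /= [Uy nA] Ay; apply: nA; exists y.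
have L0 : L !=set0.
  apply/set0P/negP => /eqP L0.
  have := avoid setT cX; rewrite L0 setI0 => /(_ erefl).
  move=> /(@filter_ex _ _ FF)[A A0].
  by have [x /A0] := hset_neq0 A; apply.
have cL : compact L.
  apply: (subclosed_compact _ cX) => // x clLx U oU Ux.
  have [y [Ly Uy]] := clLx _ (open_nbhs_nbhs (conj oU Ux)).
  exact: Ly.
exists (Hyperspace cL L0); split=> //; apply: hcvg => /=.
- move=> U oU LU; rewrite -(setCK U); apply: avoid.
    by apply: (subclosed_compact _ cX) => //; exact: open_closedC.
  by rewrite -subset0 => x [nUx /LU].
- by move=> U oU [x [Lx Ux]]; exact: Lx.
Qed.

Lemma hyperspace_hausdorff :
  compact [set: X] -> hausdorff_space X -> hausdorff_space (hyperspace X).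
Proof.
move=> cX hX.
have sep A B x : hset A x -> ~ hset B x -> exists U V,
    [/\ open U, open V, hset A `&` U !=set0, hset B `<=` V & U `&` V = set0].
  move=> Ax nBx.
  have cB : closed (hset B) by apply: compact_closed => //; exact: hset_compact.
  have rX := @compact_regular X x setT hX cX filterT _.
  have [|W Wx WB] := rX _ (~` hset B).
    by apply: open_nbhs_nbhs; split => //; exact: closed_openC.
  exists W°, (~` closure W); split.
  - exact: open_interior.
  - exact/closed_openC/closed_closure.
  - by exists x.
  - by move=> y By /WB.
  - rewrite -subset0 => y [/interior_subset Wy]; apply; exact: subset_closure.
have half A B : cluster (nbhs A) B -> hset A `<=` hset B /\ hset B `<=` hset A.
  move=> cAB; split=> x Ax; apply: contrapT => nBx.
  - have [U [V [oU oV AU BV UV]]] := sep _ _ _ Ax nBx.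
    have [C [[y [Cy Uy]] CV]] := cAB _ _ (nbhs_hhit oU AU) (nbhs_hsub oV BV).
    by have : (U `&` V) y by [split=> //; exact: CV]; rewrite UV.
  - have [U [V [oU oV AU BV UV]]] := sep _ _ _ Ax nBx.
    have [C [CV [y [Cy Uy]]]] := cAB _ _ (nbhs_hsub oV BV) (nbhs_hhit oU AU).
    by have : (U `&` V) y by [split=> //; exact: CV]; rewrite UV.
by move=> A B /half[AB BA]; apply: hset_inj; apply/seteqP.
Qed.

End HyperspaceTheory.

Record GCHobj (G : topologicalGroupType) := GCHObj {
  space :> topologicalType ;
  space_compact : compact [set: space] ;
  space_hausdorff : hausdorff_space space ;
  action : partial_action G space ;
  action_top : topological_pact action
}.

Record Gmap (G : topologicalGroupType) (a b : GCHobj G) := GMap {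
  gmap :> a -> b ;
  gmap_continuous : continuous gmap ;
  gmap_dom : forall g, gmap @` pdom (action a) g `<=` pdom (action b) g ;
  gmap_equiv : forall g x, pdom (action a) g^-1%g x ->
    gmap (pfun (action a) g x) = pfun (action b) g (gmap x)
}.

Section GCH.
Variable G : topologicalGroupType.

Lemma gmap_inj (a b : GCHobj G) : injective (@gmap G a b).
Proof.
move=> [f cf df ef] [f' cf' df' ef'] /= ff'.
move: cf df ef cf' df' ef'; rewrite ff' => *.
by congr GMap; exact: Prop_irrelevance.
Qed.

Program Definition gmap_id (a : GCHobj G) : Gmap a a := @GMap G a a id _ _ _.
Next Obligation. by move=> a x. Qed.
Next Obligation. by move=> a g; rewrite image_id. Qed.
Next Obligation. by []. Qed.

Program Definition gmap_comp (a b c : GCHobj G) (f : Gmap b c) (h : Gmap a b) :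
  Gmap a c := @GMap G a c (f \o h) _ _ _.
Next Obligation.
move=> a b c f h x.
by apply: continuous_comp; exact: gmap_continuous.
Qed.
Next Obligation.
move=> a b c f h g _ [x gx <-]; apply: gmap_dom; exists (h x) => //.
by apply: gmap_dom; exists x.
Qed.
Next Obligation.
move=> a b c f h g x gx /=; rewrite gmap_equiv// gmap_equiv//.
by apply: gmap_dom; exists x.
Qed.

Program Definition GCH : category :=
  {| ob := GCHobj G ; hom := @Gmap G ; idm := gmap_id ; comp := gmap_comp |}.
Next Obligation. by move=> a b f; exact: gmap_inj. Qed.
Next Obligation. by move=> a b f; exact: gmap_inj. Qed.
Next Obligation. by move=> a b c d h g f; exact: gmap_inj. Qed.

End GCH.

Section Induced.
Variables (G : topologicalGroupType) (X : topologicalType).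
Variables (a : partial_action G X) (ta : topological_pact a).

Lemma pfun_continuous g : {within pdom a g^-1%g, continuous (pfun a g)}.
Proof. by have [] := ta.2 g. Qed.

Lemma open_preimage_pfun g (U : set X) :
  open U -> open (pdom a g^-1%g `&` pfun a g @^-1` U).
Proof.
have oD := ta.1 g^-1%g.
have := pfun_continuous (g := g).
by rewrite continuous_open_subspace// continuous_inP//; exact.
Qed.

Lemma pfun_image_compact g (A : hyperspace X) :
  hset A `<=` pdom a g^-1%g -> compact (pfun a g @` hset A).
Proof.
move=> sA; apply: continuous_compact; last exact: hset_compact.
exact: continuous_subspaceW sA (pfun_continuous (g := g)).
Qed.

Definition hact (g : G) (A : hyperspace X) : option (hyperspace X) :=
  match pselect (hset A `<=` pdom a g^-1%g) with
  | left sA => Some (Hyperspace (pfun_image_compact sA)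
                       (image_nonempty (pfun a g) (hset_neq0 A)))
  | right _ => None
  end.

Lemma hactP g A B : hact g A = Some B <->
  hset A `<=` pdom a g^-1%g /\ hset B = pfun a g @` hset A.
Proof.
rewrite /hact; case: pselect => sA; split=> //.
- by move=> [<-].
- by move=> [_ BE]; congr Some; apply: hset_inj.
- by case.
Qed.

Program Definition induced : partial_action G (hyperspace X) :=
  @PartialAction G (hyperspace X) hact _ _ _.
Next Obligation.
move=> g A B /hactP[sA BE]; apply/hactP; rewrite BE invgK; split.
  by move=> _ [x /sA gx <-]; exact: pdom_pfun.
apply/seteqP; split=> [x Ax|_ [_ [x Ax <-] <-]].
  by exists (pfun a g x); [exists x | rewrite pfunK//; exact: sA].
by rewrite pfunK//; exact: sA.
Qed.
Next Obligation.
move=> g h A B C /hactP[sA BE] /hactP[sB CE]; apply/hactP.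
have gh x : hset A x -> a (g * h)%g x = Some (pfun a g (pfun a h x)).
  move=> Ax; apply: (pactM (pactE (sA _ Ax))); apply: pactE; apply: sB.
  by rewrite BE; exists x.
split=> [x Ax|]; first by apply/pdomVP; eexists; exact: gh.
rewrite CE BE; apply/seteqP; split=> [_ [_ [x Ax <-] <-]|_ [x Ax <-]].
  by exists x => //; exact/pfunE/gh.
by exists (pfun a h x); [exists x | exact/esym/pfunE/gh].
Qed.
Next Obligation.
move=> A; apply/hactP; split=> [x _|].
  by apply/pdomVP; exists x; exact: pact1.
apply/seteqP; split=> [x Ax|_ [x Ax <-]]; last by rewrite (pfunE (pact1 a x)).
by exists x => //; exact/pfunE/pact1.
Qed.

(* The domains of the induced partial action are the sets <X_g>. *)
Lemma pdom_induced g : pdom induced g = [set A | hset A `<=` pdom a g].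
Proof.
apply/seteqP; split=> [A /pdomP[B /hactP[]]|A sA]; first by rewrite invgK.
apply/pdomP; rewrite /= /hact; case: pselect; first by eexists.
by rewrite invgK.
Qed.

Lemma pfun_induced g (A : hyperspace X) : hset A `<=` pdom a g^-1%g ->
  hset (pfun induced g A) = pfun a g @` hset A.
Proof.
move=> sA; have : pdom induced g^-1%g A by rewrite pdom_induced.
by move=> gA; have /hactP[] : hact g A = Some _ := pactE gA.
Qed.

Lemma induced_top : topological_pact induced.
Proof.
have oi g : open (pdom induced g).
  by rewrite pdom_induced; apply: open_hsub; exact: ta.1.
apply: topological_pactI => // g.
rewrite continuous_open_subspace// => A /set_mem Ag.
have sA : hset A `<=` pdom a g^-1%g by rewrite pdom_induced in Ag.
have nA : nbhs A (hsub (pdom a g^-1%g)).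
  by apply: nbhs_hsub => //; exact: ta.1.
apply: (@hcvg _ _ _ (fmap_filter _ (nbhs_filter A))) => U oU; rewrite pfun_induced// => AU.
- have : nbhs A (hsub (pdom a g^-1%g `&` pfun a g @^-1` U)).
    apply: nbhs_hsub; first exact: open_preimage_pfun.
    by move=> x Ax; split; [exact: sA | apply: AU; exists x].
  apply: filterS => B sB; rewrite /hsub /= pfun_induced.
    by move=> _ [x /sB[_ Ux] <-].
  by move=> x /sB[].
- have : nbhs A (hhit (pdom a g^-1%g `&` pfun a g @^-1` U)).
    apply: nbhs_hhit; first exact: open_preimage_pfun.
    have [_ [[x Ax <-] Ux]] := AU.
    by exists x; split=> //; split=> //; exact: sA.
  apply: filterS2 nA => B sB [x [Bx [gx Ux]]]; rewrite /hhit /= pfun_induced//.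
  by exists (pfun a g x); split=> //; exists x.
Qed.

End Induced.

Section HyperFunctor.
Variable G : topologicalGroupType.

Definition hyper_obj (a : GCHobj G) : GCHobj G :=
  @GCHObj G (hyperspace a)
    (@hyperspace_compact a (@space_compact G a))
    (@hyperspace_hausdorff a (@space_compact G a) (@space_hausdorff G a))
    (induced (action_top a)) (induced_top (action_top a)).

Section Map.
Variables (a b : GCHobj G) (f : Gmap a b).

Lemma gmap_image_compact (A : hyperspace a) : compact (f @` hset A).
Proof.
apply: continuous_compact; last exact: hset_compact.
exact/continuous_subspaceT/gmap_continuous.
Qed.

Definition hyper_fun (A : hyperspace a) : hyperspace b :=
  Hyperspace (@gmap_image_compact A) (image_nonempty f (hset_neq0 A)).

Program Definition hyper_map : Gmap (hyper_obj a) (hyper_obj b) :=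
  @GMap G (hyper_obj a) (hyper_obj b) hyper_fun _ _ _.
Next Obligation.
move=> A; apply: (@hcvg _ _ _ (fmap_filter _ (nbhs_filter A))) => U oU AU.
- have : nbhs A (hsub (f @^-1` U)).
    apply: nbhs_hsub; last by move=> x Ax; apply: AU; exists x.
    by apply: open_comp => // x _; exact: gmap_continuous.
  by apply: filterS => B sB _ [x /sB Ux <-].
- have : nbhs A (hhit (f @^-1` U)).
    apply: nbhs_hhit; last by have [_ [[x Ax <-] Ux]] := AU; exists x.
    by apply: open_comp => // x _; exact: gmap_continuous.
  by apply: filterS => B [x [Bx Ux]]; exists (f x); split=> //; exists x.
Qed.
Next Obligation.
move=> g _ [A + <-]; rewrite !pdom_induced => sA _ [x /sA gx <-].
by apply: gmap_dom; exists x.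
Qed.
Next Obligation.
move=> g A; rewrite pdom_induced => sA; apply: hset_inj.
rewrite /= !pfun_induced//=; last first.
  by move=> _ [x /sA gx <-]; apply: gmap_dom; exists x.
apply/seteqP; split=> [_ [_ [x Ax <-] <-]|_ [_ [x Ax <-] <-]].
  by exists (f x); [exists x | rewrite gmap_equiv//; exact: sA].
by exists (pfun (action a) g x); [exists x | rewrite gmap_equiv//; exact: sA].
Qed.

End Map.

Program Definition hyper : functor (GCH G) (GCH G) :=
  @Functor (GCH G) (GCH G) hyper_obj hyper_map _ _.
Next Obligation.
by move=> a; apply/gmap_inj/funext => A; apply: hset_inj; rewrite /= image_id.
Qed.
Next Obligation.
move=> a b c g f; apply/gmap_inj/funext => A; apply: hset_inj.
by rewrite /= image_comp.
Qed.

End HyperFunctor.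

(* Main.v *)
Require Import Defs.
From mathcomp Require Import all_boot all_order finmap.
From mathcomp Require Import all_classical.
From mathcomp Require Import topology.

(** As maps of sets, the singleton [x |-> {x}] and the union [A |-> \bigcup A]
    are the unit and multiplication of the powerset monad, so naturality and the
    three monad laws are identities between images and unions. A [Gmap] is
    determined by its underlying function and a point of the hyperspace by its
    underlying set ([gmap_inj], [hset_inj]), hence these identities are all that
    has to be checked once the two maps are known to live in the category.

    For that, the only substantial point is that the union of a compact family
    of compact sets is compact ([bigcup_hyperspace_compact]), so that the union
    is again a point of the hyperspace. Continuity is then read off on the two
    kinds of subbasic open sets, [hsub U] (contained in [U]) and [hhit U]
    (meeting [U]): singletons pull them both back to [U], and the union pulls
    them back to [hsub (hsub U)] and [hhit (hhit U)]. Compatibility with the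
    partial actions holds because the induced action is the direct image, which
    commutes with singletons and unions, on the sets contained in the domain. *)

Local Open Scope classical_set_scope.

(** In terms of near coverings: a property that holds eventually near each point
    of a compact [B] holds eventually on a whole open neighbourhood [U] of [B],
    hence on every [B'] in the Vietoris neighbourhood [hsub U] of [B]. The family
    being itself compact in the Vietoris topology, these eventualities can be
    made uniform in [B]. *)
Lemma bigcup_hyperspace_compact (X : topologicalType)
    (A : set (hyperspace X)) :
  compact A -> compact (\bigcup_(B in A) hset B).
Proof.
move=> /compact_near_coveringP cA; apply/compact_near_coveringP.
move=> I F P FF nearP.
(* Properness of F is what makes its small sets form a filter below. *)
have [F0|nF0] := pselect (F set0); first by apply: filterS F0.
have PF : ProperFilter F by split.
suff : \forall i \near F, A `<=` [set B | hset B `<=` P i].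
  by apply: filterS => i AP x [B AB Bx]; exact: (AP B AB x Bx).
apply: (cA I F (fun i B => hset B `<=` P i) FF) => B AB.
(* Covering B with indices i in I would only bound B itself. Indexing by the
   small sets D of F yields one D whose open set V D contains B, that is, a
   neighbourhood hsub (V D) of B on which the property holds for all i in D. *)
pose V (D : set I) : set X := [set x | forall i, D i -> P i x]°.
have [D FD BV] : exists2 D, F D & hset B `<=` V D.
  have /compact_near_coveringP cB := @hset_compact _ B.
  have monoV D E : D `<=` E -> hset B `<=` V E -> hset B `<=` V D.
    by move=> DE BE x /BE; apply: interiorS => y Ey i /DE; exact: Ey.
  apply/(near_powerset_filter_fromP F monoV).
  apply: (cB _ (powerset_filter_from F) V _) => x Bx.
  have [[/= U D] [Ux FD] UDP] : \forall x' \near x & i \near F, P i x'.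
    by apply: nearP; exists B.
  exists (U°, [set E | F E /\ E `<=` D]) => /=.
    by split; [exact: nbhs_interior|exact: powerset_filter_fromP].
  move=> [y E] /= [Uy [_ ED]]; apply: filterS Uy => z Uz i Ei.
  by apply: (UDP (z, i)); split=> //; exact: ED.
exists (hsub (V D), D) => /=.
  by split=> //; apply: nbhs_hsub => //; exact: open_interior.
move=> [B' i] /= [B'V Di] x /B'V /interior_subset; exact.
Qed.

Section HyperspaceMonad.
Variable G : topologicalGroupType.
Implicit Types a b : GCHobj G.

Definition hset1 {X : topologicalType} (x : X) : hyperspace X :=
  Hyperspace (@compact_set1 X x) (ex_intro _ x erefl).

Lemma hset1_continuous (X : topologicalType) : continuous (@hset1 X).
Proof.
move=> x; apply: (@hcvg _ _ _ (fmap_filter _ (nbhs_filter x))) => U oU.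
- move=> /(_ x erefl) Ux.
  have : nbhs x U by exact: open_nbhs_nbhs.
  by apply: filterS => y Uy _ ->.
- move=> [_ [-> Ux]].
  have : nbhs x U by exact: open_nbhs_nbhs.
  by apply: filterS => y Uy; exists y.
Qed.

Program Definition unit_map a : Gmap a (hyper_obj a) :=
  @GMap G a (hyper_obj a) hset1 (@hset1_continuous a) _ _.
Next Obligation. by move=> a g _ [x gx <-]; rewrite pdom_induced => _ ->. Qed.
Next Obligation.
move=> a g x gx; apply: hset_inj; rewrite /= pfun_induced/= ?image_set1//.
by move=> _ ->.
Qed.

Program Definition unit_trans : nat_trans (functor_id (GCH G)) (hyper G) :=
  @NatTrans (GCH G) (GCH G) (functor_id (GCH G)) (hyper G) unit_map _.
Next Obligation.
move=> a b f; apply/gmap_inj/funext => x; apply: hset_inj.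
by rewrite /= image_set1.
Qed.

Lemma bigcup_hyperspace_neq0 (X : topologicalType)
    (A : hyperspace (hyperspace X)) : \bigcup_(B in hset A) hset B !=set0.
Proof.
by have [B AB] := hset_neq0 A; have [x Bx] := hset_neq0 B; exists x, B.
Qed.

Definition hunion {X : topologicalType} (A : hyperspace (hyperspace X)) :
    hyperspace X :=
  Hyperspace (bigcup_hyperspace_compact _ _ (@hset_compact _ A))
    (bigcup_hyperspace_neq0 _ A).

Lemma hunion_continuous (X : topologicalType) : continuous (@hunion X).
Proof.
move=> A; apply: (@hcvg _ _ _ (fmap_filter _ (nbhs_filter A))) => U oU.
- move=> AU; have : nbhs A (hsub (hsub U)).
    by apply: nbhs_hsub; [exact: open_hsub|move=> B AB x Bx; apply: AU; exists B].
  by apply: filterS => A' A'U x [B /A'U]; exact.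
- move=> [x [[B AB Bx] Ux]]; have : nbhs A (hhit (hhit U)).
    by apply: nbhs_hhit; [exact: open_hhit|exists B; split=> //; exists x].
  by apply: filterS => A' [B' [AB' [y [By Uy]]]]; exists y; split=> //; exists B'.
Qed.

Program Definition mult_map a : Gmap (hyper_obj (hyper_obj a)) (hyper_obj a) :=
  @GMap G (hyper_obj (hyper_obj a)) (hyper_obj a) hunion
    (@hunion_continuous a) _ _.
Next Obligation.
move=> a g _ [A + <-]; rewrite !pdom_induced => sA x [B /sA]; exact.
Qed.
Next Obligation.
move=> a g A; rewrite pdom_induced => sA.
have sB B : hset A B -> hset B `<=` pdom (action a) g^-1%g.
  by move=> /sA; rewrite pdom_induced.
apply: hset_inj; rewrite /= pfun_induced; last by move=> x [B /sB]; exact.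
rewrite /= pfun_induced// bigcup_image image_bigcup.
by apply: eq_bigcupr => B /sB sBg; rewrite pfun_induced.
Qed.

Program Definition mult_trans :
    nat_trans (functor_comp (hyper G) (hyper G)) (hyper G) :=
  @NatTrans (GCH G) (GCH G) (functor_comp (hyper G) (hyper G)) (hyper G)
    mult_map _.
Next Obligation.
move=> a b f; apply/gmap_inj/funext => A; apply: hset_inj.
by rewrite /= bigcup_image image_bigcup.
Qed.

End HyperspaceMonad.

Theorem theorem4p3 (G : topologicalGroupType) :
  exists (eta : nat_trans (functor_id (GCH G)) (hyper G))
         (mu : nat_trans (functor_comp (hyper G) (hyper G)) (hyper G)),
    [/\ forall (a : GCHobj G) (x : a),
          hset (gmap (eta a) x) = [set x],
        forall (a : GCHobj G) (A : hyperspace (hyperspace a)),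
          hset (gmap (mu a) A) = \bigcup_(B in hset A) hset B &
        is_monad eta mu].
Proof.
exists (unit_trans G), (mult_trans G); split=> //.
split=> a; apply/gmap_inj/funext => A; apply: hset_inj => /=.
- by rewrite bigcup_image bigcup_imset1 image_id.
- by rewrite bigcup_set1.
- by rewrite bigcup_image bigcup_bigcup.
Qed.
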